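(* Let $q$ range over powers of odd primes, and let $P\in\mathbb F_q[x_1,x_2]$ be a non-zero polynomial of degree $k\ge 1$, where the characteristic of $\mathbb F_q$ is greater than $k$. Put $V=\{x\in\mathbb F_q^2: P(x)=0\}$. Then the $L^2$–$L^4$ extension estimate $R^*(2\to 4)\lesssim 1$ for $V$ holds if and only if $P$ does not have any linear factor and $|V|\sim q$. Explicitly, with constants uniform in $q$: (i) (Sufficiency) For every integer $k\ge 1$ and every $c>0$ there exists $C=C(k,c)>0$ such that for every such $q$ and every such $P$ of degree $k$ having no linear factor and with $|V|\ge cq$, one has $R^*(2\to4)\le C$, i.e. $$\Big(\sum_{m\in\mathbb F_q^2}|(f d\sigma)^\vee(m)|^4\Big)^{1/4}\le C\Big(\frac1{|V|}\sum_{x\in V}|f(x)|^2\Big)^{1/2}\quad\text{for all } f:V\to\mathbb C .$$ (ii) (Necessity) For every integer $k\ge1$ and every $A>0$ there exist $c>0$ and $q_0$, depending only on $k$ and $A$, such that for every such $q\ge q_0$ and every such $P$ of degree $k$ with $V\neq\emptyset$, if $R^*(2\to 4)\le A$ for $V$, then $|V|\ge cq$ and $P$ has no linear factor.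
   Context: $\mathbb F_q$ is the finite field with $q$ elements and $\chi:\mathbb F_q\to\mathbb C$ is a fixed non-trivial additive character; $m\cdot x=m_1x_1+m_2x_2$. For non-empty $V\subset\mathbb F_q^2$, $d\sigma$ is the normalized surface measure $\int_V f\,d\sigma=\frac1{|V|}\sum_{x\in V}f(x)$, and for $f:V\to\mathbb C$, $$(f d\sigma)^\vee(m)=\frac1{|V|}\sum_{x\in V}\chi(m\cdot x)f(x),\qquad m\in\mathbb F_q^2 .$$ The space of $m$ carries the counting measure $dm$. $R^*(p\to r)$ is the smallest constant such that $\|(fd\sigma)^\vee\|_{L^r(\mathbb F_q^2,dm)}\le R^*(p\to r)\|f\|_{L^p(V,d\sigma)}$ for all $f:V\to\mathbb C$. The extension estimate ''holds'' ($R^*(p\to r)\lesssim1$) if $R^*(p\to r)$ is bounded by a constant independent of $q$, depending only on the degree of $P$ and on the ratio $|V|/q$. $|V|\sim q$ means $cq\le|V|\le Cq$ with constants $c,C>0$ depending only on the degree of $P$ (and not on $q$); the upper bound $|V|\le kq$ always holds by the Schwartz–Zippel lemma. A linear factor of $P$ is a polynomial of degree exactly $1$ in $\mathbb F_q[x_1,x_2]$ dividing $P$. *)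

(* Defs.v *)
From HB Require Import structures.
From mathcomp Require Import all_boot all_order all_algebra.
From mathcomp Require Import mpoly complex classical_sets reals exp.
Set Implicit Arguments.
Unset Strict Implicit.
Unset Printing Implicit Defensive.
Import Order.TTheory GRing.Theory Num.Theory.
Local Open Scope ring_scope.

(* The complex numbers are [R[i]] for [R : realType]; [normc : R[i] -> R] is
   the modulus as a real number. *)
Notation normc := ComplexField.Normc.normc.

Definition additive_character (R : realType) (F : finFieldType)
    (chi : F -> R[i]) : Prop :=
  chi 0 = 1 /\ forall a b, chi (a + b) = chi a * chi b.

Definition nontrivial_additive_character (R : realType) (F : finFieldType)
    (chi : F -> R[i]) : Prop :=
  additive_character chi /\ exists a, chi a <> 1.

Definition dot (F : finFieldType) (m x : 'rV[F]_2) : F :=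
  \sum_(i < 2) m 0 i * x 0 i.

Definition zero_set (F : finFieldType) (P : {mpoly F[2]}) : {set 'rV[F]_2} :=
  [set x : 'rV[F]_2 | P.@[x 0] == 0].

(* [msize] is one more than the total degree (and 0 for the zero polynomial). *)
Definition has_linear_factor (F : finFieldType) (P : {mpoly F[2]}) : Prop :=
  exists L Q : {mpoly F[2]}, msize L = 2%N /\ P = L * Q.

(* A function V -> C is represented by a function on the whole plane; only its
   values on V matter below. *)
Definition extension (R : realType) (F : finFieldType) (chi : F -> R[i])
    (V : {set 'rV[F]_2}) (f : 'rV[F]_2 -> R[i]) (m : 'rV[F]_2) : R[i] :=
  (#|V|%:R)^-1 * \sum_(x in V) chi (dot m x) * f x.

(* Norms for finite exponents, taken to be positive. *)
Definition norm_sigma (R : realType) (F : finFieldType)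
    (p : R) (V : {set 'rV[F]_2}) (f : 'rV[F]_2 -> R[i]) : R :=
  ((#|V|%:R)^-1 * \sum_(x in V) normc (f x) `^ p) `^ p^-1.

Definition norm_dm (R : realType) (F : finFieldType)
    (r : R) (g : 'rV[F]_2 -> R[i]) : R :=
  (\sum_(m : 'rV[F]_2) normc (g m) `^ r) `^ r^-1.

Definition extension_bound (R : realType) (F : finFieldType) (chi : F -> R[i])
    (V : {set 'rV[F]_2}) (p r A : R) : Prop :=
  0 <= A /\
  forall f : 'rV[F]_2 -> R[i],
    norm_dm r (extension chi V f) <= A * norm_sigma p V f.

Definition Rstar (R : realType) (F : finFieldType) (chi : F -> R[i])
    (V : {set 'rV[F]_2}) (p r : R) : R :=
  inf [set A : R | extension_bound chi V p r A]%classic.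

Lemma normc_sum (R : realType) (I : finType) (A : {pred I}) (g : I -> R[i]) :
  normc (\sum_(i in A) g i) <= \sum_(i in A) normc (g i).
Proof.
elim/big_ind2: _ => [|x a y b xa yb|//]; first by rewrite Normc.normc0.
by apply: le_trans (le_normcD _ _) _; exact: lerD.
Qed.

Lemma normc_ge0 (R : realType) (z : R[i]) : 0 <= normc z.
Proof. by case: z => a b; exact: sqrtr_ge0. Qed.

Lemma extension_bound_ex (R : realType) (F : finFieldType) (chi : F -> R[i])
    (V : {set 'rV[F]_2}) (p r : R) (p_gt0 : 0 < p) (r_gt0 : 0 < r) :
  exists A, extension_bound chi V p r A.
Proof.
pose B := \sum_a normc (chi a).
have B0 : 0 <= B by apply: sumr_ge0 => a _; exact: normc_ge0.
have chiB a : normc (chi a) <= B.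
  rewrite /B (bigD1 a) //= lerDl.
  by apply: sumr_ge0 => b _; exact: normc_ge0.
pose K := B * #|V|%:R `^ p^-1.
have K0 : 0 <= K by rewrite mulr_ge0 ?powR_ge0.
pose N : R := #|{: 'rV[F]_2}|%:R.
exists (N `^ r^-1 * K); split; first by rewrite mulr_ge0 ?powR_ge0.
move=> f; set s := norm_sigma p V f.
have s0 : 0 <= s by exact: powR_ge0.
have sum0 : 0 <= \sum_(x in V) normc (f x) `^ p.
  by apply: sumr_ge0 => x _; exact: powR_ge0.
have key m : normc (extension chi V f m) <= K * s.
  have [V0|V0] := eqVneq #|V| 0%N.
    rewrite /extension V0 invr0 mul0r Normc.normc0.
    by rewrite mulr_ge0.
  have cV : 0 < #|V|%:R :> R by rewrite ltr0n lt0n.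
  have fx x : x \in V -> normc (f x) <= #|V|%:R `^ p^-1 * s.
    move=> xV; rewrite /s /norm_sigma -powRM ?ler0n ?mulr_ge0 ?invr_ge0 ?ler0n//.
    rewrite mulrA divff ?gt_eqF// mul1r.
    rewrite -[leLHS](powRr1 (normc_ge0 _)) -(mulfV (lt0r_neq0 p_gt0)) powRrM.
    apply: ge0_ler_powR; rewrite ?nnegrE ?invr_ge0 ?powR_ge0 ?(ltW p_gt0)//.
    rewrite (bigD1 x) //= lerDl; apply: sumr_ge0 => y _; exact: powR_ge0.
  rewrite /extension Normc.normcM Normc.normcV.
  have -> : normc (#|V|%:R : R[i]) = #|V|%:R.
    have -> : (#|V|%:R : R[i]) = ((#|V|%:R : R)%:C)%C by rewrite rmorph_nat.
    by rewrite /Normc.normc /= expr0n addr0 sqrtr_sqr ger0_norm ?ler0n.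
  rewrite mulrC ler_pdivrMr//; apply: le_trans (normc_sum _ _) _.
  apply: (@le_trans _ _ (\sum_(x in V) K * s)).
    apply: ler_sum => x xV; rewrite Normc.normcM /K -mulrA.
    by apply: ler_pM; rewrite ?normc_ge0 ?chiB ?fx.
  by rewrite sumr_const mulr_natr.
rewrite /norm_dm -mulrA.
rewrite -[X in _ <= _ * X](powRr1 (mulr_ge0 K0 s0)).
rewrite -(mulfV (lt0r_neq0 r_gt0)) powRrM -powRM ?ler0n ?powR_ge0//.
apply: ge0_ler_powR; rewrite ?nnegrE ?invr_ge0 ?mulr_ge0 ?powR_ge0 ?ler0n ?(ltW r_gt0)//.
  by apply: sumr_ge0 => y _; exact: powR_ge0.
apply: (@le_trans _ _ (\sum_(m : 'rV[F]_2) (K * s) `^ r)).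
  apply: ler_sum => m _; apply: ge0_ler_powR;
    rewrite ?nnegrE; [exact: ltW | exact: normc_ge0 | exact: mulr_ge0 | exact: key].
by rewrite sumr_const mulr_natl.
Qed.

(* [Rstar] is indeed the smallest admissible constant. *)
Lemma Rstar_le (R : realType) (F : finFieldType) (chi : F -> R[i])
    (V : {set 'rV[F]_2}) (p r A : R) (p_gt0 : 0 < p) (r_gt0 : 0 < r) :
  Rstar chi V p r <= A <-> extension_bound chi V p r A.
Proof.
set S := [set A : R | extension_bound chi V p r A]%classic.
have lbS : has_lbound S by exists 0 => a [].
have S0 : (S !=set0)%classic by exact: extension_bound_ex.
split=> [leA|bA]; last exact: ge_inf.
have inf0 : 0 <= inf S by apply: lb_le_inf => // a [].
split; first exact: le_trans leA.
move=> f; have s0 : 0 <= norm_sigma p V f by exact: powR_ge0.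
apply: (@le_trans _ _ (inf S * norm_sigma p V f)); last by rewrite ler_wpM2r.
have [z|nz] := eqVneq (norm_sigma p V f) 0.
  by have [a [_ /(_ f)]] := S0; rewrite z !mulr0.
have sp : 0 < norm_sigma p V f by rewrite lt_def nz.
by rewrite -ler_pdivrMr//; apply: lb_le_inf => // a [_ /(_ f)]; rewrite ler_pdivrMr.
Qed.

(* Main.v *)
From HB Require Import structures.
Require Import Defs.
From mathcomp Require Import all_boot all_order all_algebra.
From mathcomp Require Import perm mpoly complex boolp reals exp zify ring.
Import Order.TTheory GRing.Theory Num.Theory.
Local Open Scope ring_scope.
Set Implicit Arguments.
Unset Strict Implicit.
Unset Printing Implicit Defensive.

(** Write [q] for [#|F|], [k] for the degree of [P] and [V] for its zero set.
    The square of the extension of [f] is, up to the factor [#|V|^-2], the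
    Fourier transform of [h xi = \sum_(x + y = xi) f x * f y], with [x] and [y]
    in [V]. Parseval's identity turns the estimate with constant [C] into
    [(q / #|V|)^2 \sum_xi |h xi|^2 <= C^4 (\sum_x |f x|^2)^2], and if
    [#|V| >= c q] the first factor is harmless ([sum_extension4]).

    Sufficiency. If [xi] has at most [n] representations [x + y], then by
    Cauchy-Schwarz [|h xi|^2] is at most [n] times the sum of
    [|f x|^2 |f y|^2] over these representations. For any other [xi],
    [|h xi| <= \sum_x |f x|^2], so it suffices that there are few of them
    ([energy_le]). The number of representations is the number of common zeros
    of [P(x)] and [P(xi - x)]. Split [P] into irreducible factors. By Bezout,
    two factors [Q] and [Q'] give a bounded number of representations unless
    [Q] and [Q'(xi - x)] have the same zeros.
    The latter happens for one [xi] only: otherwise the zeros of [Q'] would be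
    invariant under a translation, and a line would carry [k + 1] of them, since
    the characteristic exceeds [k]. Then this line would be a linear factor of
    [P] ([sparse_sums_zero_set]).

    The weak Bezout bound that is needed comes from a resultant: it bounds the
    first coordinates of common zeros, and a vertical line carries at most [k]
    zeros of a polynomial without linear factors. If the resultant vanishes,
    then the two polynomials have a common factor over [F(x)], which Gauss's
    lemma brings down to [F[x, y]] ([bezout_mirreducible]).

    Necessity. Let the estimate hold with constant [A]. The indicator of a
    point gives [q^2 <= A^4 #|V|^2]. If [P] has a linear factor, then [V]
    contains a line; the extension of its indicator has modulus [q / #|V|] at
    the [q] frequencies normal to the line, whence [q^3 <= A^4 #|V|^2]
    ([indicator_test]), which is false for large [q] because [#|V| <= 2 k q]
    ([card_zero_set_le]). *)

(** * Coordinates and sizes *)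

Lemma lift00 : lift ord0 ord0 = 1 :> 'I_2.
Proof. exact: val_inj. Qed.

Lemma ord2_neq0 (i : 'I_2) : i != 0 -> i = 1.
Proof. by case: i => [[|[|]]] // *; exact: val_inj. Qed.

Lemma rowP2 (R : Type) (x y : 'rV[R]_2) :
  x 0 0 = y 0 0 -> x 0 1 = y 0 1 -> x = y.
Proof.
move=> e0 e1; apply/rowP => i.
by have [->//|/ord2_neq0 ->] := eqVneq i 0.
Qed.

Lemma size_sum_le (R : nzRingType) (I : eqType) (s : seq I) (f : I -> {poly R}) n :
  (forall i, i \in s -> size (f i) <= n)%N -> (size (\sum_(i <- s) f i)%R <= n)%N.
Proof.
move=> le; rewrite big_seq; elim/big_ind: _ => [|a b la lb|i /le //].
  by rewrite size_poly0.
by apply: leq_trans (size_polyD _ _) _; rewrite geq_max la.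
Qed.

Lemma card_roots_le (F : finFieldType) (r : {poly F}) :
  r != 0 -> (#|[set a | root r a]| < size r)%N.
Proof.
move=> r0; rewrite cardE; apply: max_poly_roots => //; last exact: enum_uniq.
by apply/allP => a; rewrite mem_enum inE.
Qed.

(** * Gauss's lemma in two variables *)

Lemma irreducible_dvdpM (F : fieldType) (c a b : {poly F}) :
  irreducible_poly c -> c %| a * b -> (c %| a) || (c %| b).
Proof.
move=> [_ irr] cab; have [ca|nca] := boolP (c %| a) => //=.
suff cop : coprimep c a by rewrite -(Gauss_dvdpr _ cop).
apply/eqP; apply/eqP; apply: contraNT nca => g1.
by rewrite -(eqp_dvdl _ (irr _ g1 (dvdp_gcdl c a))) dvdp_gcdr.
Qed.

Lemma dvd_coefs_scale (F : fieldType) (c : {poly F}) (D : {poly {poly F}}) :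
  (forall i, c %| D`_i) -> exists D', D = c%:P * D'.
Proof.
move=> cD; exists (\poly_(i < size D) (D`_i %/ c)); apply/polyP => i.
rewrite coefCM coef_poly; case: ltnP => [_|le]; last by rewrite mulr0 nth_default.
by rewrite mulrC divpK.
Qed.

(** An irreducible [c] is a prime of [F[x][y]]: the product of the
    lowest coefficients of [D] and of [E] that [c] misses is the only term
    that [c] misses in the corresponding coefficient of [D * E]. *)
Lemma irreducible_dvd_coefsM (F : fieldType) (c : {poly F})
    (D E P : {poly {poly F}}) : irreducible_poly c -> c%:P * P = D * E ->
  (forall i, c %| D`_i) \/ (forall i, c %| E`_i).
Proof.
move=> irr eqP_; have [allD|exD] := boolP [forall i : 'I_(size D), c %| D`_i].
  left=> i; have [lt|ge] := ltnP i (size D); last by rewrite nth_default ?dvdp0.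
  by have /forallP/(_ (Ordinal lt)) := allD.
have [allE|exE] := boolP [forall i : 'I_(size E), c %| E`_i].
  right=> i; have [lt|ge] := ltnP i (size E); last by rewrite nth_default ?dvdp0.
  by have /forallP/(_ (Ordinal lt)) := allE.
have exD' : exists i, ~~ (c %| D`_i).
  by have [i ni] := forallPn exD; exists i.
have exE' : exists i, ~~ (c %| E`_i).
  by have [i ni] := forallPn exE; exists i.
have [i ni mini] := ex_minnP exD'; have [j nj minj] := ex_minnP exE'.
have : c %| (D * E)`_(i + j) by rewrite -eqP_ coefCM dvdp_mulr.
have lti : (i < (i + j).+1)%N by rewrite ltnS leq_addr.
rewrite coefM (bigD1 (Ordinal lti)) //= dvdp_addl; last first.
  elim/big_ind: _ => [|a b|l]; [exact: dvdp0 | exact: dvdp_add |].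
  rewrite -val_eqE /= => nli; have [ltl|gel] := ltnP l i.
    by apply: dvdp_mulr; apply: contraTT ltl => /mini; rewrite -leqNgt.
  apply: dvdp_mull; apply: contraNT nli => /minj le.
  have := ltn_ord l; move: le gel; clear; lia.
by rewrite addKn => /(irreducible_dvdpM irr); rewrite (negbTE ni) (negbTE nj).
Qed.

(** Gauss's lemma: a factorization of [P] up to a scalar [c] of [F[x]] becomes
    a factorization of [P], because the irreducible factors of [c] can be
    cancelled one by one from [D] or from [E]. *)
Lemma gauss_clear_scalar (F : fieldType) (c : {poly F})
    (P D E : {poly {poly F}}) : c != 0 -> c%:P * P = D * E ->
  exists (a b : {poly F}) (D' E' : {poly {poly F}}),
    [/\ D = a%:P * D', E = b%:P * E' & P = D' * E'].
Proof.
elim/ltn_ind: {c}(size c) {-2}c (erefl (size c)) P D E => n IH c sc P D E c0 eq.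
have [sc1|sc1] := eqVneq (size c) 1%N.
  have /size_poly1P[u u0 cE] : size c == 1%N by apply/eqP.
  exists u%:P, 1, ((u^-1)%:P%:P * D), E; split; rewrite ?mul1r //.
    by rewrite mulrA -!polyCM mulfV // mul1r.
  by rewrite -mulrA -eq cE mulrA -!polyCM mulVf // mul1r.
have c1 : (1 < size c)%N.
  by rewrite ltn_neqAle eq_sym sc1 size_poly_gt0.
have [irr|/existsNP[q /not_implyP[q1 /not_implyP[qc nqc]]]] :=
    pselect (forall q : {poly F}, size q != 1%N -> q %| c -> q %= c).
  have [cD|cE] := irreducible_dvd_coefsM (conj c1 irr) eq.
    have [D' DE] := dvd_coefs_scale cD; exists c, 1, D', E; split; rewrite ?mul1r//.
    by apply: (@mulfI _ c%:P); rewrite ?polyC_eq0 // eq DE mulrA.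
  have [E' EE] := dvd_coefs_scale cE; exists 1, c, D, E'; split; rewrite ?mul1r//.
  by apply: (@mulfI _ c%:P); rewrite ?polyC_eq0 // eq EE mulrCA.
(* [c] splits as [(c %/ q) * q] with both factors of smaller size. *)
have q0 : q != 0 by apply: contraNneq c0 => q0; rewrite q0 dvd0p in qc.
have r0 : c %/ q != 0.
  by apply: contraNneq c0 => r0; rewrite -(divpK qc) r0 mul0r.
have sq : (size q < size c)%N.
  by rewrite ltn_neqAle dvdp_leq // andbT; apply: contra_notN nqc; rewrite dvdp_size_eqp.
have sr : (size (c %/ q)%R < size c)%N.
  rewrite size_divp //; have : (0 < size q)%N by rewrite size_poly_gt0.
  move: q1 c1; move: (size q) (size c); clear; lia.
rewrite -(divpK qc) polyCM -mulrA in eq.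
rewrite -sc in IH.
have [a [b [D1 [E1 [-> -> eq1]]]]] := IH _ sr _ erefl _ _ _ r0 eq.
have [a' [b' [D2 [E2 [-> -> eq2]]]]] := IH _ sq _ erefl _ _ _ q0 eq1.
by exists (a * a'), (b * b'), D2, E2; rewrite !polyCM !mulrA.
Qed.

(** * Polynomials in two variables as polynomials over F[x] *)

(** The first coordinate becomes the inner variable and the second one the
    outer variable, so that resultants eliminate the second coordinate. *)
Definition bipoly (F : finFieldType) : {mpoly F[2]} -> {poly {poly F}} :=
  mmap (polyC \o polyC) (fun i : 'I_2 => if i == 0 then 'X%:P else 'X).

HB.instance Definition _ (F : finFieldType) :=
  GRing.RMorphism.on (@bipoly F).

Definition unbipoly (F : finFieldType) : {poly {poly F}} -> {mpoly F[2]} :=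
  horner_eval 'X_1 \o map_poly (horner_eval 'X_0 \o map_poly (@mpolyC 2 F)).

HB.instance Definition _ (F : finFieldType) :=
  GRing.RMorphism.on (@unbipoly F).

Lemma bipolyE (F : finFieldType) (P : {mpoly F[2]}) :
  bipoly P = \sum_(m <- msupp P) P@_m *: 'X^(m 0) *: 'X^(m 1).
Proof.
apply: eq_bigr => m _; rewrite /mmap1 big_ord_recl big_ord1 lift00 /=.
by rewrite -polyC_exp mulrA -polyCM !mul_polyC.
Qed.

Lemma horner_bipoly (F : finFieldType) (P : {mpoly F[2]}) (x : 'I_2 -> F) :
  (bipoly P).[(x 1)%:P].[x 0] = P.@[x].
Proof.
rewrite bipolyE mevalE !horner_sum; apply: eq_bigr => m _.
rewrite big_ord_recl big_ord1 lift00.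
by rewrite !(hornerZ, hornerXn, hornerM, horner_exp, hornerC) mulrA.
Qed.

Lemma unbipolyC (F : finFieldType) (a : {poly F}) :
  unbipoly a%:P = (map_poly (@mpolyC 2 F) a).['X_0].
Proof. by rewrite /unbipoly /= map_polyC /= /horner_eval hornerC. Qed.

Lemma unbipolyX (F : finFieldType) : unbipoly 'X = 'X_1 :> {mpoly F[2]}.
Proof. by rewrite /unbipoly /= map_polyX /horner_eval hornerX. Qed.

Lemma unbipolyCX (F : finFieldType) : unbipoly 'X%:P = 'X_0 :> {mpoly F[2]}.
Proof. by rewrite unbipolyC map_polyX hornerX. Qed.

Lemma bipolyC (F : finFieldType) (c : F) : bipoly c%:MP = c%:P%:P.
Proof. by rewrite /bipoly mmapC. Qed.

Lemma bipolyX (F : finFieldType) (i : 'I_2) :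
  bipoly 'X_i = (if i == 0 then 'X%:P else 'X) :> {poly {poly F}}.
Proof. by rewrite /bipoly mmapX mmap1U. Qed.

Lemma bipolyK (F : finFieldType) : cancel (@bipoly F) (@unbipoly F).
Proof.
move=> P; rewrite bipolyE rmorph_sum [RHS]mpolyE; apply: eq_bigr => m _.
rewrite -mul_polyC rmorphM rmorphXn /= unbipolyX -mul_polyC polyCM.
rewrite rmorphM polyC_exp rmorphXn /= unbipolyCX unbipolyC map_polyC hornerC.
rewrite -mulrA -mul_mpolyC; congr (_ * _); rewrite [RHS]mpolyXE_id.
by rewrite big_ord_recl big_ord1 lift00.
Qed.

Lemma unbipolyK (F : finFieldType) : cancel (@unbipoly F) (@bipoly F).
Proof.
move=> u; elim/poly_ind: u => [|u a IHu]; first by rewrite !rmorph0.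
rewrite 2!rmorphD 2!rmorphM /= IHu unbipolyX bipolyX /=; congr (_ + _).
elim/poly_ind: a => [|a c IHa]; first by rewrite polyC0 !rmorph0.
rewrite polyCD polyCM 2!rmorphD 2!rmorphM /= IHa unbipolyCX bipolyX /=.
by rewrite unbipolyC map_polyC hornerC bipolyC.
Qed.

Lemma size_bipoly (F : finFieldType) (P : {mpoly F[2]}) :
  (size (bipoly P) <= msize P)%N.
Proof.
rewrite bipolyE; apply: size_sum_le => m mP.
apply: leq_trans (size_scale_leq _ _) _; rewrite size_polyXn.
by apply: leq_trans (msize_mdeg_lt mP); rewrite ltnS mdegE big_ord_recl big_ord1 lift00 leq_addl.
Qed.

Lemma size_coef_bipoly (F : finFieldType) (P : {mpoly F[2]}) i :
  (size ((bipoly P)`_i)%R <= msize P)%N.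
Proof.
rewrite bipolyE coef_sum; apply: size_sum_le => m mP; rewrite coefZ coefXn.
case: eqP => _; last by rewrite mulr0 size_poly0.
rewrite mulr1; apply: leq_trans (size_scale_leq _ _) _; rewrite size_polyXn.
by apply: leq_trans (msize_mdeg_lt mP); rewrite ltnS mdegE big_ord_recl leq_addr.
Qed.

(** * Common zeros of two polynomials *)

Lemma size_det (R : comNzRingType) n d (M : 'M[{poly R}]_n) :
  (forall i j, size (M i j) <= d.+1)%N -> (size (\det M)%R <= (n * d).+1)%N.
Proof.
move=> leM; rewrite /determinant; apply: size_sum_le => s _.
have sgn (b : bool) (p : {poly R}) : size ((-1) ^+ b * p) = size p.
  by case: b; rewrite ?mulN1r ?mul1r ?size_polyN.
rewrite sgn.
apply: leq_trans (size_poly_prod_leq _ _) _; rewrite leq_subLR card_ord.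
have : (\sum_i size (M i (s i)) <= \sum_(i < n) d.+1)%N by exact: leq_sum.
by rewrite sum_nat_const card_ord mulnS addnS ltnS; apply.
Qed.

(** The eliminant is the resultant with respect to the outer variable, unless
    one of the two polynomials does not involve that variable and serves
    itself. *)
Lemma exists_eliminant (F : fieldType) d (P Q : {poly {poly F}}) :
    P != 0 -> Q != 0 -> (size P <= d.+1)%N -> (size Q <= d.+1)%N ->
    (forall i, size (P`_i)%R <= d.+1)%N -> (forall i, size (Q`_i)%R <= d.+1)%N ->
    (size (gcdp P Q) <= 1)%N ->
  exists r : {poly F}, [/\ r != 0, (size r <= ((d + d).+1 * d).+1)%N &
    forall x y, P.[y%:P].[x] = 0 -> Q.[y%:P].[x] = 0 -> r.[x] = 0].
Proof.
move=> P0 Q0 sP sQ cP cQ g1.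
have [P1|P1] := leqP (size P) 1.
  have PE := size1_polyC P1; exists (P`_0); split.
  - by rewrite -polyC_eq0 -PE.
  - by apply: leq_trans (cP _) _; rewrite ltnS mulSn leq_addr.
  - by move=> x y; rewrite {1}PE hornerC.
have [Q1|Q1] := leqP (size Q) 1.
  have QE := size1_polyC Q1; exists (Q`_0); split.
  - by rewrite -polyC_eq0 -QE.
  - by apply: leq_trans (cQ _) _; rewrite ltnS mulSn leq_addr.
  - by move=> x y _; rewrite {1}QE hornerC.
exists (resultant P Q); split.
- by rewrite resultant_eq0 -leqNgt.
- apply: leq_trans (@size_det _ _ d _ _) _; last first.
    rewrite ltnS leq_mul2r; apply/orP; right.
    by move: sP sQ; case: (size P) => [|m]; case: (size Q) => [|n] /=; lia.
  move=> i j; rewrite Sylvester_mxE; case: split => l /=.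
    by case: (l <= j)%N; [exact: cP | rewrite size_poly0].
  by case: (l <= j)%N; [exact: cQ | rewrite size_poly0].
- move=> x y Px Qx; have [uv _ E] := resultant_in_ideal P1 Q1.
  have := congr1 (fun u : {poly {poly F}} => u.[y%:P].[x]) E.
  by rewrite hornerC => ->; rewrite hornerD !hornerM hornerD !hornerM Px Qx !mulr0 addr0.
Qed.

Definition mirreducible (F : finFieldType) (P : {mpoly F[2]}) : Prop :=
  (1 < msize P)%N /\
  forall A B, P = A * B -> (msize A <= 1)%N \/ (msize B <= 1)%N.

(** [%|] over the domain [F[x]] is divisibility up to a power of the leading
    coefficient; Gauss's lemma removes that power from the quotient. *)
Lemma pseudo_dvd_split (F : fieldType) (g S : {poly {poly F}}) :
  g != 0 -> g %| S ->
  exists (a : {poly F}) (D E : {poly {poly F}}), g = a%:P * D /\ S = D * E.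
Proof.
move=> g0; rewrite Pdiv.Idomain.dvdp_eq => /eqP; rewrite mulrC -mul_polyC => e.
have c0 : lead_coef g ^+ scalp S g != 0 by rewrite expf_neq0 ?lead_coef_eq0.
by have [a [b [D [E [gD _ SE]]]]] := gauss_clear_scalar c0 e; exists a, D, E.
Qed.

(** A common factor [g] over the field [F(x)] has, by Gauss's lemma, an
    associate [D] that divides [P] and then an associate [D'] of [D] that
    divides [Q]. As it is irreducible, [P] is a constant times [D']. *)
Lemma mirreducible_dvd (F : finFieldType) (P Q : {mpoly F[2]}) :
  mirreducible P -> (1 < size (gcdp (bipoly P) (bipoly Q)))%N ->
  exists B, Q = P * B.
Proof.
move=> [P1 irr] g1; set g := gcdp _ _ in g1.
have P0 : P != 0 by rewrite -msize_poly_eq0 -lt0n ltnW.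
have g0 : g != 0 by rewrite -size_poly_gt0 ltnW.
have [a [D [E [gD PE]]]] := pseudo_dvd_split g0 (dvdp_gcdl _ _).
have D0 : D != 0 by apply: contraNneq g0 => D0; rewrite gD D0 mulr0.
have DQ : D %| bipoly Q.
  by apply: dvdp_trans (dvdp_gcdr (bipoly P) _); rewrite -/g gD dvdp_mull.
have [a' [D' [E' [DD' QE']]]] := pseudo_dvd_split D0 DQ.
have sD' : (1 < size D')%N.
  have a0 : a != 0 by apply: contraNneq g0 => a0; rewrite gD a0 mul0r.
  have a'0 : a' != 0 by apply: contraNneq D0 => a'0; rewrite DD' a'0 mul0r.
  by move: g1; rewrite gD DD' !mul_polyC !size_scale.
have PE2 : P = unbipoly D' * unbipoly (a'%:P * E).
  by rewrite -rmorphM /= mulrCA mulrA -DD' -PE bipolyK.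
have [/msize1_polyC e|/msize1_polyC e] := irr _ _ PE2.
  have := congr1 (@bipoly F) e; rewrite unbipolyK bipolyC => e'.
  by move: sD'; rewrite e' ltnNge size_polyC_leq1.
have c0 : (unbipoly (a'%:P * E))@_0%MM != 0.
  by apply: contraNneq P0 => c0; rewrite PE2 e c0 mpolyC0 mulr0.
move: PE2; rewrite e; move: c0; set c := _@__ => c0 PE2.
exists ((c^-1)%:MP * unbipoly E').
rewrite PE2 mulrA -[_ * _ * (c^-1)%:MP]mulrA -mpolyCM mulfV // mulr1.
by rewrite -rmorphM /= -QE' bipolyK.
Qed.

(** A weak form of Bezout's theorem: an eliminant leaves boundedly many values
    for the first coordinate of a common zero, and each vertical line carries
    few zeros of [P]. *)
Lemma bezout_mirreducible (F : finFieldType) d (P Q : {mpoly F[2]}) :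
    mirreducible P -> (msize P <= d.+1)%N -> (msize Q <= d.+1)%N ->
    (forall a, #|[set x in zero_set P | x 0%R 0%R == a]| <= d)%N ->
  (#|zero_set P :&: zero_set Q| <= (d + d).+1 * d * d)%N \/
  exists B, Q = P * B.
Proof.
move=> irr sP sQ fib.
have P0 : P != 0 by case: irr => P1 _; rewrite -msize_poly_eq0 -lt0n ltnW.
have [Q0|Q0] := eqVneq Q 0; first by right; exists 0; rewrite mulr0.
have [g1|g1] := leqP (size (gcdp (bipoly P) (bipoly Q))) 1; last first.
  by right; exact: mirreducible_dvd.
left; have inj := can_inj (@bipolyK F).
have [||||||r [r0 sr rP]] := @exists_eliminant F d (bipoly P) (bipoly Q) _ _ _ _ _ _ g1.
- by rewrite -(rmorph0 (@bipoly F)) (inj_eq inj).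
- by rewrite -(rmorph0 (@bipoly F)) (inj_eq inj).
- exact: leq_trans (size_bipoly _) sP.
- exact: leq_trans (size_bipoly _) sQ.
- by move=> i; exact: leq_trans (size_coef_bipoly _ _) sP.
- by move=> i; exact: leq_trans (size_coef_bipoly _ _) sQ.
pose A := [set a | root r a].
have cA : (#|A| <= (d + d).+1 * d)%N.
  by have := leq_trans (card_roots_le r0) sr; rewrite ltnS.
rewrite -sum1_card (partition_big (fun x : 'rV[F]_2 => x 0 0) (mem A)) /=; last first.
  move=> x; rewrite !inE => /andP[/eqP Px /eqP Qx]; apply/eqP.
  by apply: (rP _ (x 0 1)); rewrite -[x 0 0]/((x 0) 0) horner_bipoly.
apply: (@leq_trans (\sum_(a in A) d)); last first.
  by rewrite sum_nat_const leq_mul2r cA orbT.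
apply: leq_sum => a _; rewrite sum1dep_card; apply: leq_trans (fib a).
by apply: subset_leq_card; apply/subsetP => x; rewrite !inE => /andP[/andP[-> _] ->].
Qed.

(** * Zeros on lines *)

(** The restriction of a polynomial to the line [u + t v], as a polynomial in
    the parameter [t]. *)
Definition line_poly (F : finFieldType) (u v : 'rV[F]_2) : {mpoly F[2]} -> {poly F} :=
  mmap polyC (fun i : 'I_2 => (u 0 i)%:P + v 0 i *: 'X).

Lemma line_polyE (F : finFieldType) (u v : 'rV[F]_2) P : line_poly u v P =
  \sum_(m <- msupp P) P@_m *: (((u 0 0)%:P + v 0 0 *: 'X) ^+ m 0 *
                               ((u 0 1)%:P + v 0 1 *: 'X) ^+ m 1).
Proof.
apply: eq_bigr => m _; rewrite /mmap1 big_ord_recl big_ord1 lift00.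
by rewrite mul_polyC.
Qed.

Lemma horner_line_poly (F : finFieldType) (u v : 'rV[F]_2) P t :
  (line_poly u v P).[t] = P.@[(u + t *: v) 0].
Proof.
rewrite line_polyE mevalE horner_sum; apply: eq_bigr => m _.
rewrite big_ord_recl big_ord1 lift00 hornerZ hornerM !horner_exp !mxE.
by rewrite !(hornerD, hornerZ, hornerC, hornerX) ![_ * t]mulrC.
Qed.

Lemma size_affine_exp (F : fieldType) (a b : F) n :
  (size ((a%:P + b *: 'X) ^+ n)%R <= n.+1)%N.
Proof.
apply: leq_trans (size_poly_exp_leq _ _) _; rewrite ltnS.
rewrite -[leqRHS]mul1n leq_mul2r -subn1 leq_subLR.
apply/orP; right; apply: leq_trans (size_polyD _ _) _.
rewrite geq_max (leq_trans (size_polyC_leq1 _)) //=.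
by apply: leq_trans (size_scale_leq _ _) _; rewrite size_polyX.
Qed.

Lemma size_line_poly (F : finFieldType) (u v : 'rV[F]_2) P :
  (size (line_poly u v P) <= msize P)%N.
Proof.
rewrite line_polyE; apply: size_sum_le => m mP.
apply: leq_trans (msize_mdeg_lt mP); apply: leq_trans (size_scale_leq _ _) _.
apply: leq_trans (size_polyMleq _ _) _.
rewrite mdegE big_ord_recl big_ord1 lift00 -[m ord0]/(m 0).
have := size_affine_exp (u 0 0) (v 0 0) (m 0).
have := size_affine_exp (u 0 1) (v 0 1) (m 1).
by move: (size _) (size _) => a b; lia.
Qed.

(** Congruence modulo [L] is compatible with sums and products, so replacing
    the variables by congruent polynomials does not change [P] modulo [L]. *)
Lemma mmap_cong (F : finFieldType) (L : {mpoly F[2]}) (g : 'I_2 -> {mpoly F[2]}) :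
  (forall i, exists E, 'X_i = g i + L * E) ->
  forall P : {mpoly F[2]}, exists Q, P = mmap (@mpolyC 2 F) g P + L * Q.
Proof.
move=> gL.
have congM a b c d : (exists E, a = b + L * E) -> (exists E, c = d + L * E) ->
    exists E, a * c = b * d + L * E.
  move=> [E ->] [E' ->]; exists (b * E' + E * (d + L * E')).
  by rewrite mulrDl !mulrDr !addrA !mulrA [b * L]mulrC.
have congX a b n : (exists E, a = b + L * E) -> exists E, a ^+ n = b ^+ n + L * E.
  move=> ab; elim: n => [|n IH]; first by exists 0; rewrite mulr0 addr0 !expr0.
  by rewrite !exprS; exact: congM.
elim/mpolyind => [|c m P _ _ [Q PQ]]; first by exists 0; rewrite rmorph0 mulr0 addr0.
have [E mE] : exists E, 'X_[m] = mmap1 g m + L * E.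
  rewrite [X in exists E, X = _]mpolyXE_id /mmap1 !big_ord_recl !big_ord0 !mulr1 lift00.
  by apply: congM; exact: congX.
exists (c%:MP * E + Q); rewrite rmorphD -!mul_mpolyC rmorphM /= mmapC mmapX.
by rewrite {1}PQ mE; ring.
Qed.

Lemma msize_linear (F : finFieldType) (i j : 'I_2) (b c : F) : i != j ->
  msize ('X_j + (b *: 'X_i + c%:MP)) = 2%N.
Proof.
move=> nij; apply/eqP; rewrite eqn_leq; apply/andP; split.
  apply: leq_trans (msizeD_le _ _) _; rewrite geq_max msizeX mdeg1 leqnn /=.
  apply: leq_trans (msizeD_le _ _) _; rewrite geq_max msizeC (leq_trans (leq_b1 _)) ?andbT //.
  by apply: leq_trans (msizeZ_le _ _) _; rewrite msizeX mdeg1.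
have : U_(j)%MM \in msupp ('X_j + (b *: 'X_i + c%:MP)).
  rewrite mcoeff_msupp !mcoeffD mcoeffZ !mcoeffX mcoeffC eqxx.
  have /negbTE -> : U_(i)%MM != U_(j)%MM :> 'X_{1..2}.
    by apply: contraNneq nij => /mnmP/(_ i); rewrite !mnm1E eqxx; case: eqP => // ->.
  have /negbTE -> : U_(j)%MM != 0%MM :> 'X_{1..2}.
    by apply/eqP => /mnmP/(_ j); rewrite mnm1E mnm0E eqxx.
  by rewrite !mulr0 !addr0 oner_neq0.
by move/msize_mdeg_lt; rewrite mdeg1.
Qed.

(** On a line, the coordinates are affine functions of a parameter [t], itself an
    affine function of one of them. Modulo the equation [L] of the line, [P] is
    thus the restriction of [P] to the line, evaluated at [t]; if this
    restriction vanishes then [L] divides [P]. *)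
Lemma line_factor (F : finFieldType) (u v : 'rV[F]_2) P :
  v != 0 -> line_poly u v P = 0 -> has_linear_factor P.
Proof.
move=> /rV0Pn[i vi] lP0.
pose j := if i == 0 then 1 else 0 : 'I_2.
have ij k : k != i -> k = j.
  rewrite /j; case: k => [[|[|k]] lk] //; case: (i) => [[|[|l]] li] //= _; exact: val_inj.
have nij : (i == j) = false.
  by rewrite /j; case: (i) => [[|[|l]] li].
(* The parameter on the line, as a function of the i-th coordinate. *)
pose t := ((v 0 i)^-1)%:MP * ('X_i - (u 0 i)%:MP) : {mpoly F[2]}.
pose L := 'X_j - ((u 0 j)%:MP + (v 0 j)%:MP * t).
pose g k := (u 0 k)%:MP + (v 0 k)%:MP * t.
have [|Q PQ] := @mmap_cong F L g _ P.
  move=> k; have [->|/ij ->] := eqVneq k i.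
    by exists 0; rewrite mulr0 addr0 /g /t mulrA -mpolyCM mulfV // mul1r addrC subrK.
  by exists 1; rewrite mulr1 /L /g addrC subrK.
pose ev : {rmorphism {poly F} -> {mpoly F[2]}} := horner_eval t \o map_poly (@mpolyC 2 F).
have evC c : ev c%:P = c%:MP by rewrite /ev /= map_polyC /horner_eval hornerC.
have evX : ev 'X = t by rewrite /ev /= map_polyX /horner_eval hornerX.
have mg : mmap (@mpolyC 2 F) g P = ev (line_poly u v P).
  rewrite line_polyE (rmorph_sum ev); apply: eq_bigr => m _.
  rewrite /mmap1 big_ord_recl big_ord1 lift00 -!mul_polyC.
  by rewrite !(rmorphM ev) !(rmorphXn ev) !(rmorphD ev) !(rmorphM ev) !evC !evX.
exists L, Q; split; last by rewrite PQ mg lP0 rmorph0 add0r.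
have -> : L = 'X_j + ((- (v 0 j / v 0 i)) *: 'X_i + (v 0 j / v 0 i * u 0 i - u 0 j)%:MP).
  by rewrite /L /t -mul_mpolyC !(mpolyCN, mpolyCM, mpolyCB); ring.
by apply: msize_linear; rewrite nij.
Qed.

(** A line with at least [msize P] zeros would be a component of the curve. *)
Lemma card_line_zeros (F : finFieldType) (P : {mpoly F[2]}) (u v : 'rV[F]_2) :
  ~ has_linear_factor P -> v != 0 ->
  (#|[set t | (u + t *: v)%R \in zero_set P]| < msize P)%N.
Proof.
move=> nlf v0; have l0 : line_poly u v P != 0.
  by apply/eqP => l0; exact: nlf (line_factor v0 l0).
apply: leq_trans (size_line_poly u v P); apply: leq_ltn_trans (card_roots_le l0).
apply: subset_leq_card; apply/subsetP => t.
by rewrite !inE rootE horner_line_poly.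
Qed.

Lemma card_fiber_le (F : finFieldType) (S : {set 'rV[F]_2}) a :
  (#|[set x in S | x 0%R 0%R == a]| <=
   #|[set y | (a *: delta_mx 0 0 + y *: delta_mx 0 1)%R \in S]|)%N.
Proof.
rewrite -(card_in_imset (f := fun x : 'rV[F]_2 => x 0 1)); last first.
  by move=> x y; rewrite !inE => /andP[_ /eqP xa] /andP[_ /eqP ya] xy; apply: rowP2; rewrite ?xa.
apply: subset_leq_card; apply/subsetP => t /imsetP[x].
rewrite !inE => /andP[Px /eqP xa] ->.
suff -> : a *: delta_mx 0 0 + x 0 1 *: delta_mx 0 1 = x by [].
by apply: rowP2; rewrite !mxE /= !(mulr1, mulr0, addr0, add0r).
Qed.

Lemma card_vertical_zeros (F : finFieldType) (P : {mpoly F[2]}) a :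
  ~ has_linear_factor P ->
  (#|[set x in zero_set P | x 0%R 0%R == a]| < msize P)%N.
Proof.
move=> nlf; pose e1 : 'rV[F]_2 := delta_mx 0 1.
have e10 : e1 != 0.
  by apply/eqP => /matrixP/(_ 0 1)/eqP; rewrite !mxE !eqxx oner_eq0.
exact: leq_ltn_trans (card_fiber_le _ _) (card_line_zeros _ nlf e10).
Qed.

(** * Reflection and factorization *)

Lemma msizeM_leq (F : fieldType) n (A B : {mpoly F[n]}) :
  (msize (A * B)%R <= (msize A + msize B).-1)%N.
Proof.
have [->|A0] := eqVneq A 0; first by rewrite mul0r msize0.
have [->|B0] := eqVneq B 0; first by rewrite mulr0 msize0.
by rewrite msizeM.
Qed.

Lemma msizeX_le (F : fieldType) n (A : {mpoly F[n]}) e :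
  (msize A <= 2)%N -> (msize (A ^+ e)%R <= e.+1)%N.
Proof.
move=> A2; elim: e => [|e IH]; first by rewrite expr0 msize1.
rewrite exprS; apply: leq_trans (msizeM_leq _ _) _.
by move: (msize _) (msize _) A2 IH => a b; lia.
Qed.

Definition reflect_poly (F : finFieldType) (xi : 'rV[F]_2) : {mpoly F[2]} -> {mpoly F[2]} :=
  mmap (@mpolyC 2 F) (fun i => (xi 0 i)%:MP - 'X_i).

Lemma horner_reflect_poly (F : finFieldType) (xi x : 'rV[F]_2) P :
  (reflect_poly xi P).@[x 0] = P.@[(xi - x) 0].
Proof.
rewrite /reflect_poly /mmap [RHS]mevalE rmorph_sum; apply: eq_bigr => m _.
rewrite rmorphM rmorph_prod /= mevalC; congr (_ * _); apply: eq_bigr => i _.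
by rewrite rmorphXn /= mevalB mevalC mevalXU !mxE.
Qed.

Lemma zero_set_reflect_poly (F : finFieldType) (xi : 'rV[F]_2) P :
  zero_set (reflect_poly xi P) = [set x | xi - x \in zero_set P].
Proof. by apply/setP => x; rewrite !inE horner_reflect_poly. Qed.

Lemma msize_reflect_poly (F : finFieldType) (xi : 'rV[F]_2) P :
  (msize (reflect_poly xi P) <= msize P)%N.
Proof.
rewrite /reflect_poly /mmap big_seq; elim/big_ind: _ => [|A B lA lB|m mP].
- by rewrite msize0.
- by apply: leq_trans (msizeD_le _ _) _; rewrite geq_max lA.
rewrite mul_mpolyC; apply: leq_trans (msizeZ_le _ _) _.
apply: leq_trans (msize_mdeg_lt mP); rewrite mdegE /mmap1.
have fac i : (msize ((xi 0%R i)%:MP - 'X_i : {mpoly F[2]})%R <= 2)%N.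
  apply: leq_trans (msizeD_le _ _) _; rewrite geq_max msizeC msizeN msizeX mdeg1 andbT.
  exact: leq_trans (leq_b1 _) _.
elim/big_rec2: _ => [|i A e _ IH]; first by rewrite msize1.
apply: leq_trans (msizeM_leq _ _) _.
by have := msizeX_le (m i) (fac i); move: (msize _) (msize _) IH => a b; lia.
Qed.

Lemma zero_setM (F : finFieldType) (A B : {mpoly F[2]}) :
  zero_set (A * B) = zero_set A :|: zero_set B.
Proof. by apply/setP => x; rewrite !inE mevalM mulf_eq0. Qed.

Lemma zero_set1 (F : finFieldType) : zero_set (1 : {mpoly F[2]}) = set0.
Proof. by apply/setP => x; rewrite !inE meval1 oner_eq0. Qed.

Lemma mpoly_factor (F : finFieldType) (P : {mpoly F[2]}) : (1 < msize P)%N ->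
  exists s : seq {mpoly F[2]}, [/\ P = \prod_(Q <- s) Q, (size s < msize P)%N &
    forall Q, Q \in s -> mirreducible Q /\ (msize Q <= msize P)%N].
Proof.
have [n] := ubnP (msize P); elim: n P => // n IH P; rewrite ltnS => nP P1.
have [irr|nirr] := pselect (mirreducible P).
  by exists [:: P]; split=> [|//|Q]; rewrite ?big_seq1 // inE => /eqP ->.
have [A [B [PE A1 B1]]] : exists A B, [/\ P = A * B, (1 < msize A)%N & (1 < msize B)%N].
  apply: contrapT => no; apply: nirr; split=> // A B PE.
  have [|A1] := leqP (msize A) 1; first by left.
  have [|B1] := leqP (msize B) 1; first by right.
  by case: no; exists A, B.
have A0 : A != 0 by rewrite -msize_poly_eq0 -lt0n ltnW.
have B0 : B != 0 by rewrite -msize_poly_eq0 -lt0n ltnW.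
have sP : msize P = (msize A + msize B).-1 by rewrite PE msizeM.
have lA : (msize A < msize P)%N by rewrite sP; move: (msize A) (msize B) A1 B1 => a b; lia.
have lB : (msize B < msize P)%N by rewrite sP; move: (msize A) (msize B) A1 B1 => a b; lia.
have [s [As ss sA]] := IH _ (leq_trans lA nP) A1.
have [t [Bt st tB]] := IH _ (leq_trans lB nP) B1.
exists (s ++ t); split; first by rewrite big_cat /= -As -Bt.
  by rewrite size_cat sP; move: (msize A) (msize B) ss st A1 B1 => a b; lia.
move=> Q; rewrite mem_cat => /orP[/sA|/tB] [irrQ le]; split=> //.
  exact: leq_trans le (ltnW lA).
exact: leq_trans le (ltnW lB).
Qed.

Definition sum_count (F : finFieldType) (S T : {set 'rV[F]_2}) (xi : 'rV[F]_2) :=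
  #|[set x in S | xi - x \in T]|.

Lemma sum_countC (F : finFieldType) (S T : {set 'rV[F]_2}) xi :
  sum_count S T xi = sum_count T S xi.
Proof.
rewrite /sum_count -(card_imset _ (can_inj (subKr xi))); apply: eq_card => y.
apply/imsetP/idP => [[x]|]; rewrite inE => /andP[xS xT].
  by move=> ->; rewrite inE xT subKr.
by exists (xi - y); rewrite ?inE subKr // xS xT.
Qed.

Definition sparse_sums (F : finFieldType) (S T : {set 'rV[F]_2}) b n :=
  exists B : {set 'rV[F]_2}, (#|B| <= b)%N /\
    forall xi, xi \notin B -> (sum_count S T xi <= n)%N.

Lemma sparse_sumsC (F : finFieldType) (S T : {set 'rV[F]_2}) b n :
  sparse_sums S T b n -> sparse_sums T S b n.
Proof. by move=> [B [cB le]]; exists B; split=> // xi; rewrite sum_countC => /le. Qed.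

Lemma sparse_sums_prod (F : finFieldType) (s : seq {mpoly F[2]}) T k b n :
  (size s <= k)%N -> (forall Q, Q \in s -> sparse_sums (zero_set Q) T b n) ->
  sparse_sums (zero_set (\prod_(Q <- s) Q)) T (k * b) (k * n).
Proof.
elim: s k => [|Q s IH] k sk h.
  exists set0; rewrite cards0; split=> // xi _; rewrite /sum_count big_nil zero_set1.
  by rewrite (_ : [set x in set0 | _] = set0) ?cards0 //; apply/setP => x; rewrite !inE.
case: k sk => // k sk; have [B [cB leB]] := h Q (mem_head _ _).
have [|B' [cB' leB']] := IH k sk; first by move=> S Ss; apply: h; rewrite inE Ss orbT.
exists (B :|: B'); split.
  by rewrite mulSn; apply: leq_trans (leq_card_setU _ _) (leq_add cB cB').
move=> xi; rewrite in_setU negb_or => /andP[/leB le /leB' le'].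
rewrite mulSn; apply: leq_trans (leq_add le le').
rewrite big_cons zero_setM /sum_count; apply: leq_trans (leq_card_setU _ _).
by apply: subset_leq_card; apply/subsetP => x; rewrite !inE andb_orl.
Qed.

Lemma natr_pchar_inj (F : finFieldType) p k : p \in [pchar F] -> (k < p)%N ->
  injective (fun n : 'I_k.+1 => n%:R : F).
Proof.
move=> pF kp; suff le (m n : 'I_k.+1) : (m <= n)%N -> m%:R = n%:R :> F -> m = n.
  by move=> m n mn; case: (leqP m n) => [/le->//|/ltnW/le->].
move=> mn /esym/eqP; rewrite -subr_eq0 -natrB // -(dvdn_pcharf pF) => pdvd.
apply: val_inj; apply/eqP; rewrite eqn_leq mn /= -subn_eq0; apply: contraLR pdvd => ne.
rewrite gtnNdvd ?lt0n //; apply: leq_ltn_trans (leq_subr _ _) _.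
exact: leq_trans (ltn_ord n) kp.
Qed.

(** * Few sums have many representations *)

(** The points counted by [sum_count] are the common zeros of [P] and of the
    reflected polynomial [Q(xi - x)], so that Bezout applies. *)
Lemma sum_count_gt (F : finFieldType) d (P Q : {mpoly F[2]}) xi :
    mirreducible P -> (msize P <= d.+1)%N -> (msize Q <= d.+1)%N ->
    (forall a, #|[set x in zero_set P | x 0%R 0%R == a]| <= d)%N ->
    ((d + d).+1 * d * d < sum_count (zero_set P) (zero_set Q) xi)%N ->
  forall x, x \in zero_set P -> xi - x \in zero_set Q.
Proof.
move=> irr sP sQ fib lt x Px.
have sR := leq_trans (msize_reflect_poly xi Q) sQ.
have [le|[B QB]] := bezout_mirreducible irr sP sR fib.
  move: lt; rewrite ltnNge => /negP[]; apply: leq_trans le.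
  rewrite zero_set_reflect_poly /sum_count.
  by apply: subset_leq_card; apply/subsetP => y; rewrite !inE.
have : x \in zero_set (reflect_poly xi Q) by rewrite QB zero_setM inE Px.
by rewrite zero_set_reflect_poly inE.
Qed.

(** For irreducible factors [Qi] and [Qj] with zero sets [Zi] and [Zj], at most
    one [xi] has more representations as a sum from [Zi] and [Zj] than the bound
    of [sum_count_gt]: such a [xi] gives [Zi = xi - Zj], and two of them would
    make [Zj] invariant under a translation [v != 0]. Then [Zj] would contain
    [a], [a + v], ..., [a + k v], which are [k + 1] distinct points since
    [k < p], on one line. *)
Lemma sparse_sums_zero_set (F : finFieldType) p k (P : {mpoly F[2]}) :
    p \in [pchar F] -> (k < p)%N -> (0 < k)%N -> msize P = k.+1 ->
    ~ has_linear_factor P ->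
  sparse_sums (zero_set P) (zero_set P) (k * k)
    (k * (k * ((k + k).+1 * k * k))).
Proof.
move=> pF kp k0 sP nlf; have -> : (k * k = k * (k * 1))%N by rewrite muln1.
have [|s [Ps ss sI]] := @mpoly_factor F P; first by rewrite sP ltnS.
have sk : (size s <= k)%N by rewrite -ltnS -sP.
rewrite {1}Ps; apply: (sparse_sums_prod sk) => Qi Qis.
apply: sparse_sumsC; rewrite Ps; apply: (sparse_sums_prod sk) => Qj Qjs.
have sub Q : Q \in s -> {subset zero_set Q <= zero_set P}.
  by move=> Qs x Qx; rewrite Ps (big_rem Q) //= zero_setM inE Qx.
have fib Q : Q \in s -> forall a, (#|[set x in zero_set Q | x 0%R 0%R == a]| <= k)%N.
  move=> Qs a; rewrite -ltnS -sP; apply: leq_trans (card_vertical_zeros a nlf).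
  rewrite ltnS; apply: subset_leq_card; apply/subsetP => x.
  by rewrite !inE => /andP[Qx ->]; rewrite andbT; have := sub Q Qs x; rewrite !inE; apply.
set n := (_ * k)%N.
exists [set xi | (n < sum_count (zero_set Qj) (zero_set Qi) xi)%N].
split; last by move=> xi; rewrite inE -leqNgt.
have [irri sQi] := sI _ Qis; have [irrj sQj] := sI _ Qjs; rewrite sP in sQi sQj.
apply/card_le1_eqP => xi xi'; rewrite !inE => big big'; apply/eqP.
apply: contraT => neq.
(* From here on, two exceptional sums [xi != xi'] lead to a contradiction. *)
have mv := sum_count_gt irrj sQj sQi (fib _ Qjs) big'.
rewrite sum_countC in big.
have mv' := sum_count_gt irri sQi sQj (fib _ Qis) big.
pose v := xi - xi'.
have v0 : v != 0 by rewrite subr_eq0 eq_sym.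
have shift x : x \in zero_set Qj -> x + v \in zero_set Qj.
  by move=> /mv/mv'; rewrite opprB addrC -addrA [- _ + _]addrC.
have [a Qa] : exists a, a \in zero_set Qj.
  apply/set0Pn; apply: contraTneq big' => Q0; rewrite -leqNgt /sum_count Q0.
  by rewrite (_ : [set x in set0 | _] = set0) ?cards0 //; apply/setP => x; rewrite !inE.
have orbit m : a + m%:R *: v \in zero_set Qj.
  elim: m => [|m IH]; first by rewrite scale0r addr0.
  by rewrite mulrSr scalerDl scale1r addrA shift.
have := card_line_zeros a nlf v0; rewrite sP ltnS leqNgt => /negP[].
rewrite -[k.+1]card_ord -(card_imset predT (natr_pchar_inj pF kp)).
apply: subset_leq_card; apply/subsetP => t /imsetP[m _ ->].
by rewrite inE; apply: (sub Qj Qjs).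
Qed.

(** * Characters and Parseval's identity *)

Lemma normcX (R : realType) (z : R[i]) n : normc (z ^+ n) = normc z ^+ n.
Proof. by elim: n => [|n IH]; rewrite ?expr0 ?Normc.normc1 // !exprS Normc.normcM IH. Qed.

Lemma sqr_normcE (R : realType) (z : R[i]) :
  ((normc z ^+ 2)%:C = z * z^*)%C.
Proof. by rewrite rmorphXn -sqr_normc. Qed.

Lemma character0 (R : realType) (F : finFieldType) (chi : F -> R[i]) :
  additive_character chi -> chi 0 = 1.
Proof. by case. Qed.

Lemma characterD (R : realType) (F : finFieldType) (chi : F -> R[i]) :
  additive_character chi -> {morph chi : a b / a + b >-> a * b}.
Proof. by case. Qed.

Lemma characterMn (R : realType) (F : finFieldType) (chi : F -> R[i]) :
  additive_character chi -> forall a n, chi (a *+ n) = chi a ^+ n.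
Proof.
move=> chiP a; elim=> [|n IH]; first by rewrite mulr0n (character0 chiP).
by rewrite mulrS (characterD chiP) IH exprS.
Qed.

Lemma normc_character (R : realType) (F : finFieldType) (chi : F -> R[i]) p :
  p \in [pchar F] -> additive_character chi -> forall a, normc (chi a) = 1.
Proof.
move=> pF chiP a; have p0 : (0 < p)%N by exact: prime_gt0 (pcharf_prime pF).
have e : normc (chi a) ^+ p = 1.
  by rewrite -normcX -(characterMn chiP) (mulrn_pchar pF) (character0 chiP) Normc.normc1.
by apply/eqP; rewrite -(pexpr_eq1 p0) ?normc_ge0 // e.
Qed.

Lemma characterN (R : realType) (F : finFieldType) (chi : F -> R[i]) p :
  p \in [pchar F] -> additive_character chi ->
  forall a, chi (- a) = ((chi a)^*)%C.
Proof.
move=> pF chiP a; have ca0 : chi a != 0.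
  apply/eqP => ca0; have := normc_character pF chiP a; rewrite ca0 Normc.normc0.
  by move/eqP; rewrite eq_sym oner_eq0.
apply: (mulfI ca0); rewrite -(characterD chiP) subrr (character0 chiP).
by rewrite -sqr_normcE (normc_character pF chiP) expr1n.
Qed.

Lemma sum_character (R : realType) (F : finFieldType) (chi : F -> R[i]) (x : 'rV[F]_2) :
  nontrivial_additive_character chi ->
  \sum_m chi (dot m x) = if x == 0 then #|{: 'rV[F]_2}|%:R else 0.
Proof.
move=> [chiP [a ca]]; have [->|x0] := eqVneq x 0.
  rewrite (eq_bigr (fun => 1)) ?sumr_const // => m _.
  by rewrite /dot big1 ?(character0 chiP) // => i _; rewrite mxE mulr0.
have /rV0Pn[i xi] := x0.
(* Translating [m] by [w] multiplies every term by [chi a != 1]. *)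
pose w : 'rV[F]_2 := (a / x 0 i) *: delta_mx 0 i.
have dotw m : dot (w + m) x = a + dot m x.
  rewrite /dot (eq_bigr (fun k => w 0 k * x 0 k + m 0 k * x 0 k)); last first.
    by move=> k _; rewrite mxE mulrDl.
  rewrite big_split /= (bigD1 i) //= big1 ?addr0.
    by rewrite !mxE !eqxx mulr1 divfK.
  by move=> k ki; rewrite !mxE (negbTE ki) andbF mulr0 mul0r.
have E : \sum_m chi (dot m x) = chi a * \sum_m chi (dot m x).
  rewrite {1}(reindex_inj (addrI w)) mulr_sumr; apply: eq_bigr => m _.
  by rewrite dotw (characterD chiP).
apply/eqP; have /eqP : (chi a - 1) * \sum_m chi (dot m x) = 0.
  by rewrite mulrBl mul1r -E subrr.
by rewrite mulf_eq0 subr_eq0 => /orP[/eqP|].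
Qed.

Lemma dotDr (F : finFieldType) (m x y : 'rV[F]_2) : dot m (x + y) = dot m x + dot m y.
Proof. by rewrite /dot -big_split; apply: eq_bigr => i _; rewrite mxE mulrDr. Qed.

Lemma dotNr (F : finFieldType) (m x : 'rV[F]_2) : dot m (- x) = - dot m x.
Proof. by rewrite /dot -sumrN; apply: eq_bigr => i _; rewrite mxE mulrN. Qed.

Lemma parseval (R : realType) (F : finFieldType) (chi : F -> R[i]) p (h : 'rV[F]_2 -> R[i]) :
  p \in [pchar F] -> nontrivial_additive_character chi ->
  \sum_m normc (\sum_xi chi (dot m xi) * h xi) ^+ 2 =
  #|{: 'rV[F]_2}|%:R * \sum_xi normc (h xi) ^+ 2.
Proof.
move=> pF chi_nt; have chiP := proj1 chi_nt; apply: (@complexI R).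
rewrite rmorphM !rmorph_sum /= rmorph_nat.
under eq_bigr => m _.
  rewrite sqr_normcE rmorph_sum mulr_suml.
  under eq_bigr => xi _ do rewrite mulr_sumr.
  over.
rewrite exchange_big mulr_sumr; apply: eq_bigr => xi _ /=.
rewrite exchange_big (bigD1 xi) //= [X in _ + X]big1 ?addr0.
  rewrite (eq_bigr (fun => (normc (h xi) ^+ 2)%:C%C)).
    by rewrite sumr_const mulr_natl.
  move=> m _; rewrite rmorphM /= sqr_normcE mulrACA -(sqr_normcE (chi _)) (normc_character pF chiP).
  by rewrite expr1n mul1r.
move=> eta ne; transitivity (\sum_m h xi * (h eta)^*%C * chi (dot m (xi - eta))).
  apply: eq_bigr => m _; rewrite rmorphM /=.
  rewrite -[(chi _)^*]/((chi (dot m eta))^*%C) -[(h _)^*]/((h eta)^*%C).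
  rewrite -(characterN pF chiP) dotDr dotNr (characterD chiP).
  by ring.
by rewrite -mulr_sumr (sum_character _ chi_nt) subr_eq0 eq_sym (negbTE ne) mulr0.
Qed.

Lemma sqr_sum_le (R : realDomainType) (I : finType) (A : {set I}) (a : I -> R) :
  (\sum_(i in A) a i) ^+ 2 <= #|A|%:R * \sum_(i in A) a i ^+ 2.
Proof.
rewrite -(ler_pMn2r (ltn0Sn 1)) expr2 mulr_suml.
under eq_bigr do rewrite mulr_sumr.
have -> : #|A|%:R * (\sum_(i in A) a i ^+ 2) *+ 2 =
   \sum_(i in A) \sum_(j in A) (a i ^+ 2 + a j ^+ 2).
  under [RHS]eq_bigr => i _ do rewrite big_split /= sumr_const.
  by rewrite big_split /= sumr_const sumrMnl mulr_natl mulr2n.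
rewrite -sumrMnl; apply: ler_sum => i _; rewrite -sumrMnl; apply: ler_sum => j _.
rewrite -subr_ge0 (_ : _ - _ = (a i - a j) ^+ 2) ?sqr_ge0 //; ring.
Qed.

(** * Additive energy and the extension operator *)

Definition self_convolution (R : realType) (F : finFieldType)
    (V : {set 'rV[F]_2}) (f : 'rV[F]_2 -> R[i]) (xi : 'rV[F]_2) : R[i] :=
  \sum_(x in [set x in V | xi - x \in V]) f x * f (xi - x).

Lemma sum_pairs_by_sum (R : nmodType) (F : finFieldType) (V : {set 'rV[F]_2})
    (g : 'rV[F]_2 -> 'rV[F]_2 -> R) :
  \sum_xi \sum_(x in [set x in V | xi - x \in V]) g x (xi - x) =
  \sum_(x in V) \sum_(y in V) g x y.
Proof.
under eq_bigr => xi _.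
  rewrite (eq_bigl (fun x => (x \in V) && (xi - x \in V))); last by move=> x; rewrite inE.
  rewrite big_mkcondr; over.
rewrite exchange_big; apply: eq_bigr => x _ /=.
rewrite [RHS]big_mkcond (reindex_inj (addrI x)); apply: eq_bigr => y _ /=.
by rewrite addrC addKr.
Qed.

Lemma extension_sqr (R : realType) (F : finFieldType) (chi : F -> R[i])
    (V : {set 'rV[F]_2}) f m : additive_character chi ->
  extension chi V f m ^+ 2 = (#|V|%:R ^+ 2)^-1 *
    \sum_xi chi (dot m xi) * self_convolution V f xi.
Proof.
move=> chiP; rewrite /extension exprMn exprVn; congr (_ * _).
rewrite expr2 mulr_suml.
under eq_bigr do rewrite mulr_sumr.
rewrite -sum_pairs_by_sum; apply: eq_bigr => xi _; rewrite mulr_sumr.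
apply: eq_bigr => x _; rewrite mulrACA -(characterD chiP) -dotDr.
by rewrite addrC subrK.
Qed.

Lemma normc_nat (R : realType) n : normc (n%:R : R[i]) = n%:R.
Proof.
have -> : (n%:R : R[i]) = ((n%:R : R)%:C)%C by rewrite rmorph_nat.
by rewrite /Normc.normc /= expr0n addr0 sqrtr_sqr ger0_norm ?ler0n.
Qed.

(** The square of the extension is the Fourier transform of a convolution. *)
Lemma sum_extension4 (R : realType) (F : finFieldType) (chi : F -> R[i]) p
    (V : {set 'rV[F]_2}) f :
  p \in [pchar F] -> nontrivial_additive_character chi ->
  \sum_m normc (extension chi V f m) ^+ 4 = (#|V|%:R ^+ 4)^-1 *
   (#|F|%:R ^+ 2 * \sum_xi normc (self_convolution V f xi) ^+ 2).
Proof.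
move=> pF chi_nt; have := parseval (self_convolution V f) pF chi_nt.
rewrite card_mx mul1n natrX => <-; rewrite mulr_sumr; apply: eq_bigr => m _.
rewrite -[4%N]/(2 * 2)%N exprM -normcX (extension_sqr _ _ _ (proj1 chi_nt)).
by rewrite Normc.normcM Normc.normcV normcX normc_nat exprMn exprVn -exprM.
Qed.

(** Outside the exceptional sums, Cauchy-Schwarz loses a factor [n], the bound on
    the number of representations. At each of the [b] exceptional ones, the value of the
    convolution is at most the square of the L^2 norm. *)
Lemma energy_le (R : realType) (F : finFieldType) (V : {set 'rV[F]_2})
    (f : 'rV[F]_2 -> R[i]) b n : sparse_sums V V b n ->
  \sum_xi normc (self_convolution V f xi) ^+ 2 <=
    (b + n)%:R * (\sum_(x in V) normc (f x) ^+ 2) ^+ 2.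
Proof.
move=> [B [cB leB]]; set M := \sum_(x in V) _.
have M0 : 0 <= M by apply: sumr_ge0 => x _; rewrite sqr_ge0.
pose S xi := [set x in V | xi - x \in V].
pose G xi := \sum_(x in S xi) normc (f x) ^+ 2 * normc (f (xi - x)) ^+ 2.
have G0 xi : 0 <= G xi by apply: sumr_ge0 => x _; rewrite mulr_ge0 ?sqr_ge0.
have sumG : \sum_xi G xi = M ^+ 2.
  rewrite /G (sum_pairs_by_sum V (fun x y => normc (f x) ^+ 2 * normc (f y) ^+ 2)).
  by rewrite expr2 mulr_suml; apply: eq_bigr => x _; rewrite mulr_sumr.
have tri xi : normc (self_convolution V f xi) <=
    \sum_(x in S xi) normc (f x) * normc (f (xi - x)).
  by apply: le_trans (normc_sum _ _) _; apply: ler_sum => x _; rewrite Normc.normcM.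
have good xi : xi \notin B -> normc (self_convolution V f xi) ^+ 2 <= n%:R * G xi.
  move=> /leB cS.
  apply: le_trans (_ : (\sum_(x in S xi) normc (f x) * normc (f (xi - x))) ^+ 2 <= _).
    by rewrite ler_pXn2r ?nnegrE ?normc_ge0 // (le_trans _ (tri xi)) ?normc_ge0.
  apply: le_trans (sqr_sum_le _ _) _.
  under eq_bigr do rewrite exprMn.
  by rewrite ler_wpM2r ?G0 // ler_nat.
have bad xi : normc (self_convolution V f xi) ^+ 2 <= M ^+ 2.
  rewrite ler_pXn2r ?nnegrE ?normc_ge0 //; apply: le_trans (tri xi) _.
  rewrite -(ler_pMn2r (ltn0Sn 1)) -sumrMnl.
  apply: (@le_trans _ _ (\sum_(x in S xi) (normc (f x) ^+ 2 + normc (f (xi - x)) ^+ 2))).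
    apply: ler_sum => x _; rewrite -subr_ge0.
    by rewrite (_ : _ - _ = (normc (f x) - normc (f (xi - x))) ^+ 2) ?sqr_ge0 //; ring.
  rewrite big_split mulr2n /=; apply: lerD.
    rewrite /M big_mkcond [leRHS]big_mkcond; apply: ler_sum => x _.
    by rewrite inE; case: (x \in V) => //=; case: ifP => // _; rewrite sqr_ge0.
  rewrite /M big_mkcond [leRHS]big_mkcond /= [leRHS](reindex_inj (subrI xi)) /=.
  apply: ler_sum => x _.
  by rewrite inE andbC; case: (xi - x \in V) => //=; case: ifP => // _; rewrite sqr_ge0.
rewrite (bigID (mem B)) /= natrD mulrDl; apply: lerD.
  apply: (@le_trans _ _ (\sum_(xi in B) M ^+ 2)); first by apply: ler_sum => xi _.
  by rewrite sumr_const -[leLHS]mulr_natl ler_wpM2r ?sqr_ge0 // ler_nat.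
apply: (@le_trans _ _ (\sum_(xi | xi \notin B) n%:R * G xi)).
  by apply: ler_sum => xi; exact: good.
rewrite -mulr_sumr ler_wpM2l ?ler0n // -sumG [leRHS](bigID (mem B)) /= lerDr.
by apply: sumr_ge0.
Qed.

(** The bound, raised to the fourth power to get rid of real exponents. *)
Lemma extension_bound24P (R : realType) (F : finFieldType) (chi : F -> R[i])
    (V : {set 'rV[F]_2}) (A : R) : 0 <= A ->
  extension_bound chi V 2 4 A <->
  forall f, \sum_m normc (extension chi V f m) ^+ 4 <=
    A ^+ 4 * (#|V|%:R^-1 * \sum_(x in V) normc (f x) ^+ 2) ^+ 2.
Proof.
move=> A0.
have powRV4 (a : R) k n : 0 <= a -> (0 < k)%N -> (a `^ (k%:R)^-1) ^+ (k * n) = a ^+ n.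
  move=> a0 k0; rewrite exprM -(powR_mulrn k (powR_ge0 _ _)) -powRrM mulVf ?powRr1 //.
  by rewrite pnatr_eq0 -lt0n.
have sum4 (g : 'rV[F]_2 -> R[i]) : norm_dm 4 g ^+ 4 = \sum_m normc (g m) ^+ 4.
  rewrite /norm_dm (powRV4 _ 4 1) //; last by apply: sumr_ge0 => m _; exact: powR_ge0.
  by rewrite expr1; apply: eq_bigr => m _; rewrite powR_mulrn ?normc_ge0.
have sum2 f : norm_sigma 2 V f ^+ 4 =
    (#|V|%:R^-1 * \sum_(x in V) normc (f x) ^+ 2) ^+ 2 :> R.
  rewrite /norm_sigma (powRV4 _ 2 2) //; last first.
    by rewrite mulr_ge0 ?invr_ge0 ?ler0n //; apply: sumr_ge0 => m _; exact: powR_ge0.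
  by congr ((_ * _) ^+ _); apply: eq_bigr => m _; rewrite powR_mulrn ?normc_ge0.
have eqv f : (norm_dm 4 (extension chi V f) <= A * norm_sigma 2 V f) =
    (\sum_m normc (extension chi V f m) ^+ 4 <=
    A ^+ 4 * (#|V|%:R^-1 * \sum_(x in V) normc (f x) ^+ 2) ^+ 2).
  rewrite -sum4 -sum2 -exprMn ler_pXn2r // nnegrE ?mulr_ge0 //; exact: powR_ge0.
split=> [[_ h] f|h]; first by rewrite -eqv.
by split=> // f; rewrite eqv.
Qed.

(** * Test functions and the size of the zero set *)

(** The test function is the indicator of [L]; its extension has modulus
    [#|L| / #|V|] at each frequency of [D]. *)
Lemma indicator_test (R : realType) (F : finFieldType) (chi : F -> R[i]) p
    (V L D : {set 'rV[F]_2}) (A : R) :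
    p \in [pchar F] -> additive_character chi ->
    L \subset V -> L != set0 ->
    (forall m, m \in D -> exists a, forall x, x \in L -> dot m x = a) ->
    extension_bound chi V 2 4 A ->
  #|D|%:R * #|L|%:R ^+ 2 <= A ^+ 4 * #|V|%:R ^+ 2.
Proof.
move=> pF chiP LV L0 cst [A0 bnd].
have {bnd} := (extension_bound24P chi V A0).1 (conj A0 bnd) (fun x => (x \in L)%:R).
have l0 : 0 < #|L|%:R :> R by rewrite ltr0n card_gt0.
have v0 : 0 < #|V|%:R :> R by rewrite ltr0n (leq_trans _ (subset_leq_card LV)) // card_gt0.
have -> : \sum_(x in V) normc ((x \in L)%:R : R[i]) ^+ 2 = #|L|%:R.
  rewrite -sum1_card natr_sum [RHS]big_mkcond [LHS]big_mkcond; apply: eq_bigr => x _.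
  have := subsetP LV x; case: (x \in L) => [->//|_].
    by rewrite normc_nat expr1n.
  by rewrite normc_nat expr0n; case: ifP.
have big m : m \in D -> normc (extension chi V (fun x => (x \in L)%:R) m) = #|L|%:R / #|V|%:R.
  move=> /cst[a ma]; rewrite /extension.
  have -> : \sum_(x in V) chi (dot m x) * (x \in L)%:R = chi a * #|L|%:R.
    rewrite -sum1_card natr_sum mulr_sumr [RHS]big_mkcond [LHS]big_mkcond; apply: eq_bigr => x _.
    have := subsetP LV x; have := ma x; case: (x \in L) => [-> // -> //|_ _].
    by rewrite mulr0; case: ifP.
  rewrite !Normc.normcM Normc.normcV !normc_nat (normc_character pF chiP) mul1r.
  by rewrite mulrC.
move=> le; have {le} : \sum_(m in D) (#|L|%:R / #|V|%:R) ^+ 4 <=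
    A ^+ 4 * (#|V|%:R^-1 * #|L|%:R) ^+ 2.
  apply: le_trans le; rewrite big_mkcond; apply: ler_sum => m _.
  case: ifP => [mD|_]; first by rewrite big.
  by rewrite exprn_ge0 ?normc_ge0.
rewrite sumr_const -[leLHS]mulr_natl => le.
rewrite -(ler_pM2r (_ : 0 < #|L|%:R ^+ 2 / #|V|%:R ^+ 4)); last first.
  by rewrite divr_gt0 ?exprn_gt0.
apply: le_trans (_ : #|D|%:R * (#|L|%:R / #|V|%:R) ^+ 4 <= _).
  by rewrite le_eqVlt; apply/orP; left; apply/eqP; field; rewrite gt_eqF.
apply: le_trans le _.
by rewrite le_eqVlt; apply/orP; left; apply/eqP; field; rewrite gt_eqF.
Qed.

(** The leading coefficient of [P] in the second variable vanishes on at most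
    [k] vertical lines, and every other one carries at most [k] zeros. *)
Lemma card_zero_set_le (F : finFieldType) (P : {mpoly F[2]}) k :
  msize P = k.+1 -> (#|zero_set P| <= 2 * k * #|F|)%N.
Proof.
move=> sP; have P0 : bipoly P != 0.
  by rewrite -(rmorph0 (@bipoly F)) (inj_eq (can_inj (@bipolyK F))) -msize_poly_eq0 sP.
pose c := lead_coef (bipoly P).
have c0 : c != 0 by rewrite lead_coef_eq0.
have sc : (size c <= k.+1)%N by rewrite -sP; exact: size_coef_bipoly.
pose A := [set a | root c a].
have cA : (#|A| <= k)%N by rewrite -ltnS; exact: leq_trans (card_roots_le c0) sc.
rewrite -sum1_card (partition_big (fun x : 'rV[F]_2 => x 0 0) predT) //=.
have fibq a : (\sum_(x in zero_set P | x 0%R 0%R == a) 1 <= #|F|)%N.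
  by rewrite sum1dep_card; apply: leq_trans (card_fiber_le _ _) (max_card _).
have fibk a : a \notin A -> (\sum_(x in zero_set P | x 0%R 0%R == a) 1 <= k)%N.
  rewrite inE => nra; rewrite sum1dep_card; apply: leq_trans (card_fiber_le _ _) _.
  pose g := map_poly (horner_eval a) (bipoly P).
  have g0 : g != 0.
    apply: contraNneq nra => g0; have /polyP/(_ (size (bipoly P)).-1) := g0.
    by rewrite coef_map coef0 -/(lead_coef _) /horner_eval => /eqP; rewrite rootE.
  rewrite -ltnS; apply: leq_ltn_trans (leq_trans (card_roots_le g0) _); last first.
    by apply: leq_trans (size_poly _ _) _; rewrite -sP; exact: size_bipoly.
  apply: subset_leq_card; apply/subsetP => y; rewrite !inE rootE => /eqP Py; apply/eqP.
  rewrite -[y](hornerC y a) -/(horner_eval a y%:P) horner_map /= /horner_eval -[RHS]Py.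
  by rewrite -horner_bipoly !mxE !eqxx /= !(mulr1, mulr0, addr0, add0r).
rewrite (bigID (mem A)) /= mul2n -addnn mulnDl; apply: leq_add.
  apply: leq_trans (leq_sum _ (fun a _ => fibq a)) _.
  by rewrite sum_nat_const leq_mul2r cA orbT.
apply: leq_trans (leq_sum _ fibk) _; rewrite sum_nat_const mulnC leq_mul2l max_card orbT.
by [].
Qed.

Lemma msize2E (F : finFieldType) (L : {mpoly F[2]}) : msize L = 2%N ->
  exists (n : 'rV[F]_2) (c : F), n != 0 /\
    forall x : 'rV[F]_2, L.@[x 0] = dot n x + c.
Proof.
move=> sL; pose n : 'rV[F]_2 := \row_i L@_(U_(i)).
have LE : L = (L@_0%MM)%:MP + \sum_i (n 0 i) *: 'X_i.
  apply/mpolyP => m; rewrite mcoeffD mcoeffC raddf_sum /=.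
  have [m2|m2] := leqP 2 (mdeg m).
    have /memN_msupp_eq0 -> : m \notin msupp L by apply: msize_mdeg_ge; rewrite sL.
    have /negbTE -> : m != 0%MM by apply: contraTneq m2 => ->; rewrite mdeg0.
    rewrite mulr0 add0r big1 // => i _; rewrite mcoeffZ mcoeffX.
    by case: eqP m2 => [<-|]; rewrite ?mdeg1 ?mulr0.
  move: m2; rewrite ltnS leq_eqVlt => /orP[/mdeg1P[i /eqP ->]|].
    have /negbTE -> : U_(i)%MM != 0%MM :> 'X_{1..2}.
      by apply/eqP => /(congr1 mdeg)/eqP; rewrite mdeg1 mdeg0.
    rewrite mulr0 add0r (bigD1 i) //= mcoeffZ mcoeffX eqxx mulr1 mxE big1 ?addr0 //.
    move=> k ki; rewrite mcoeffZ mcoeffX.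
    case: eqP => [/mnmP/(_ k)|]; last by rewrite mulr0.
    by rewrite !mnm1E eqxx eq_sym (negbTE ki).
  rewrite ltnS leqn0 mdeg_eq0 => /eqP ->.
  rewrite eqxx mulr1 big1 ?addr0 // => i _; rewrite mcoeffZ mcoeffX.
  by case: eqP => [/(congr1 mdeg)|]; rewrite ?mdeg1 ?mdeg0 ?mulr0.
exists n, L@_0%MM; split.
  apply: contra_eq_neq sL => n0; rewrite LE n0 big1 ?addr0.
    by rewrite msizeC; case: (_ != 0).
  by move=> i _; rewrite mxE scale0r.
move=> x; rewrite {1}LE mevalD mevalC addrC; congr (_ + _).
rewrite /dot raddf_sum; apply: eq_bigr => i _.
by rewrite /= mevalZ mevalXU.
Qed.

(** [D] consists of the multiples of the normal vector of the line. *)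
Lemma linear_zero_set (F : finFieldType) (L : {mpoly F[2]}) : msize L = 2%N ->
  (#|F| <= #|zero_set L|)%N /\
  exists2 D : {set 'rV[F]_2}, #|D| = #|F| &
    forall m, m \in D -> exists a, forall x, x \in zero_set L -> dot m x = a.
Proof.
move=> sL; have [n [c [n0 LE]]] := msize2E sL.
have line (u v : 'rV[F]_2) : v != 0 -> injective (fun t => u + t *: v).
  move=> v0 s t /addrI/eqP; rewrite -subr_eq0 -scalerBl scaler_eq0 (negbTE v0) orbF.
  by rewrite subr_eq0 => /eqP.
have dot2 (m x : 'rV[F]_2) : dot m x = m 0 0 * x 0 0 + m 0 1 * x 0 1.
  by rewrite /dot big_ord_recl big_ord1 lift00.
have eq0 (w : 'rV[F]_2) : w 0 0 = 0 -> w 0 1 = 0 -> w = 0.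
  by move=> w0 w1; apply: rowP2; rewrite mxE.
split.
  (* A direction of the line. *)
  pose v : 'rV[F]_2 := \row_i (if i == 0 then - n 0 1 else n 0 0).
  have v0 : v != 0.
    apply: contraNneq n0 => v0; apply/eqP/eq0.
      by have := congr1 (fun w : 'rV[F]_2 => w 0 1) v0; rewrite !mxE.
    by have /eqP := congr1 (fun w : 'rV[F]_2 => w 0 0) v0; rewrite !mxE oppr_eq0 => /eqP.
  have [u Lu] : exists u : 'rV[F]_2, dot n u + c = 0.
    have [a0|a0] := eqVneq (n 0 0) 0.
      have b0 : n 0 1 != 0 by apply: contraNneq n0 => b0; apply/eqP/eq0.
      exists (\row_i (if i == 0 then 0 else - c / n 0 1)).
      by rewrite dot2 !mxE /=; field.
    exists (\row_i (if i == 0 then - c / n 0 0 else 0)).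
    by rewrite dot2 !mxE /=; field.
  rewrite -(card_imset predT (line u v v0)); apply: subset_leq_card.
  apply/subsetP => x /imsetP[t _ ->]; rewrite inE LE -Lu; apply/eqP.
  by rewrite !dot2 !mxE /=; ring.
exists [set s *: n | s : F].
  rewrite card_imset // => s t /eqP.
  by rewrite -subr_eq0 -scalerBl scaler_eq0 (negbTE n0) orbF subr_eq0 => /eqP.
move=> m /imsetP[s _ ->]; exists (s * - c) => x; rewrite inE LE addr_eq0 => /eqP <-.
by rewrite !dot2 !mxE mulrDr !mulrA.
Qed.

(** * The extension theorem *)

Theorem theorem1p1 (R : realType) :
  (forall (k : nat) (c : R), (1 <= k)%N -> 0 < c ->
     exists C : R, 0 < C /\
     forall (F : finFieldType) (p : nat) (chi : F -> R[i]) (P : {mpoly F[2]}),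
       p \in [pchar F] -> odd p -> (k < p)%N ->
       nontrivial_additive_character chi ->
       msize P = k.+1 ->
       ~ has_linear_factor P ->
       c * #|F|%:R <= #|zero_set P|%:R ->
       Rstar chi (zero_set P) 2 4 <= C)
  /\
  (forall (k : nat) (A : R), (1 <= k)%N -> 0 < A ->
     exists (c : R) (q0 : nat), 0 < c /\
     forall (F : finFieldType) (p : nat) (chi : F -> R[i]) (P : {mpoly F[2]}),
       p \in [pchar F] -> odd p -> (k < p)%N ->
       nontrivial_additive_character chi ->
       (q0 <= #|F|)%N ->
       msize P = k.+1 ->
       zero_set P != set0 ->
       Rstar chi (zero_set P) 2 4 <= A ->
       c * #|F|%:R <= #|zero_set P|%:R /\ ~ has_linear_factor P).
Proof.
split=> k.
  move=> c k0 c0; pose N := (k * k + k * (k * ((k + k).+1 * k * k)))%N.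
  (* [1 <= C] makes [C ^+ 4] at least the constant [N / c ^ 2] of the estimate. *)
  pose C : R := 1 + N%:R / c ^+ 2.
  have NC : N%:R / c ^+ 2 <= C ^+ 4.
    have C1 : 1 <= C by rewrite lerDl divr_ge0 ?ler0n ?sqr_ge0.
    by apply: le_trans (ler_eXnr _ C1); rewrite // lerDr.
  have C0 : 0 < C by rewrite ltr_wpDr ?divr_ge0 ?ler0n ?sqr_ge0.
  exists C; split=> // F p chi P pF _ kp chi_nt sP nlf big.
  apply/(Rstar_le _ _ _ (ltr0n _ 2) (ltr0n _ 4))/(extension_bound24P _ _ (ltW C0)) => f.
  have en := energy_le f (sparse_sums_zero_set pF kp k0 sP nlf).
  rewrite (sum_extension4 _ _ pF chi_nt) -/N in en *.
  set V := zero_set P in big en *; set M := \sum_(x in V) _ in en *.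
  have q0 : 0 < #|F|%:R :> R by rewrite ltr0n (cardD1 0).
  have v0 : 0 < #|V|%:R :> R by apply: lt_le_trans big; rewrite mulr_gt0.
  apply: le_trans (_ : (#|V|%:R ^+ 4)^-1 * (#|F|%:R ^+ 2 * (N%:R * M ^+ 2)) <= _).
    by rewrite ler_wpM2l ?invr_ge0 ?exprn_ge0 ?ler0n // ler_wpM2l ?exprn_ge0 ?ler0n.
  apply: le_trans (_ : N%:R / c ^+ 2 * (#|V|%:R^-1 * M) ^+ 2 <= _); last first.
    by rewrite ler_wpM2r ?sqr_ge0.
  have -> : (#|V|%:R ^+ 4)^-1 * (#|F|%:R ^+ 2 * (N%:R * M ^+ 2)) =
      N%:R / c ^+ 2 * (#|V|%:R^-1 * M) ^+ 2 * ((c * #|F|%:R) ^+ 2 / #|V|%:R ^+ 2).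
    by field; rewrite !gt_eqF.
  rewrite ler_piMr ?(mulr_ge0 (divr_ge0 (ler0n _ _) (sqr_ge0 _)) (sqr_ge0 _)) //.
  rewrite ler_pdivrMr ?exprn_gt0 // mul1r ler_pXn2r // nnegrE ?ler0n //.
  by rewrite mulr_ge0 // ltW.
move=> A k0 A0; pose X : R := A ^+ 4 * (2 * k)%:R ^+ 2.
exists (A ^- 2), (Num.bound X); split; first by rewrite invr_gt0 exprn_gt0.
move=> F p chi P pF _ kp chi_nt q0 sP VN bnd.
have {}bnd := (Rstar_le chi (zero_set P) A (ltr0n _ 2) (ltr0n _ 4)).1 bnd.
have [chiP _] := chi_nt.
have cF : 0 < #|F|%:R :> R by rewrite ltr0n (cardD1 0).
set V := zero_set P in VN bnd *.
split.
  (* Test the indicator of a point against all frequencies. *)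
  have [x Vx] := set0Pn _ VN.
  have xV : [set x] \subset V by rewrite sub1set.
  have xN : [set x] != set0 by rewrite -card_gt0 cards1.
  have cst (m : 'rV[F]_2) : m \in setT -> exists a, forall y, y \in [set x] -> dot m y = a.
    by move=> _; exists (dot m x) => y; rewrite inE => /eqP ->.
  have := indicator_test pF chiP xV xN cst bnd.
  rewrite cardsT card_mx mul1n natrX cards1 expr1n mulr1.
  rewrite (_ : A ^+ 4 * #|V|%:R ^+ 2 = (A ^+ 2 * #|V|%:R) ^+ 2); last by ring.
  rewrite ler_pXn2r ?nnegrE ?(mulr_ge0 (sqr_ge0 A) (ler0n _ _)) ?ler0n // => le.
  by rewrite ler_pdivrMl ?exprn_gt0.
move=> [L [Q [sL PE]]]; have [qL [D cD cst]] := linear_zero_set sL.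
have LV : zero_set L \subset V by rewrite /V PE zero_setM subsetUl.
have LN : zero_set L != set0.
  by rewrite -card_gt0 (leq_trans _ qL) // (cardD1 0).
have := indicator_test pF chiP LV LN cst bnd; rewrite cD => le.
(* Hence [q ^ 3 <= A ^ 4 #|V| ^ 2 <= A ^ 4 (2 k q) ^ 2], so that [q <= X]. *)
have qL' : #|F|%:R <= #|zero_set L|%:R :> R by rewrite ler_nat.
have Vq : #|V|%:R <= (2 * k)%:R * #|F|%:R :> R by rewrite -natrM ler_nat card_zero_set_le.
have : X < #|F|%:R.
  by apply: lt_le_trans (archi_boundP _) _; rewrite ?ler_nat // mulr_ge0 ?exprn_ge0 ?ler0n // ltW.
apply/negP; rewrite -leNgt -(ler_pM2r (exprn_gt0 2 cF)).
apply: le_trans (_ : #|F|%:R * #|zero_set L|%:R ^+ 2 <= _).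
  by rewrite ler_wpM2l ?ler0n // ler_pXn2r ?nnegrE ?ler0n.
apply: le_trans le _; rewrite /X -[leRHS]mulrA -exprMn ler_wpM2l ?exprn_ge0 ?(ltW A0) //.
by rewrite ler_pXn2r ?nnegrE ?mulr_ge0 ?ler0n.
Qed.
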